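(* The complete tripartite graphs $K_{1,1,1}$, $K_{1,1,2}$, $K_{1,2,2}$, $K_{2,2,2}$ and $K_{2,2,3}$ are $e$-positive, and every other complete tripartite graph $K_{r,s,t}$ (with $r,s,t\ge1$) is not Schur positive.
   Context: $K_{r,s,t}$ denotes the complete tripartite graph with parts of sizes $r,s,t$. For a finite simple graph $G$, the chromatic symmetric function is $X_G=\sum_{\kappa}\prod_{v\in V(G)}x_{\kappa(v)}$ over proper colorings $\kappa:V(G)\to\{1,2,\dots\}$. $G$ is $e$-positive (resp. Schur positive) if all coefficients of $X_G$ in the basis of elementary symmetric functions $e_\lambda$ (resp. Schur functions $s_\lambda$) are nonnegative. *)

(* Defs.v *)
From mathcomp Require Import all_boot all_order all_algebra.
From mathcomp Require Import mpoly.
Set Implicit Arguments. Unset Strict Implicit. Unset Printing Implicit Defensive.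
Import Order.TTheory GRing.Theory Num.Theory.
Local Open Scope ring_scope.

(* Symmetric functions of degree n are represented by their images in n
   variables x_0,...,x_{n-1}, i.e. in {mpoly rat[n]}; for degree n this
   restriction is injective and the e_lambda, s_lambda (lambda |- n)
   restrict to bases. *)

Definition proper_coloring (T : finType) (adj : rel T) (n : nat)
    (kappa : {ffun T -> 'I_n}) : bool :=
  [forall u, forall v, adj u v ==> (kappa u != kappa v)].

Definition chromsym (T : finType) (adj : rel T) : {mpoly rat[#|T|]} :=
  \sum_(kappa : {ffun T -> 'I_#|T|} | proper_coloring adj kappa)
     \prod_(v : T) 'X_(kappa v).

(* Partitions of n, encoded as nonincreasing sequences lambda_0 >= ... >=
   lambda_{n-1} >= 0 (padded with zeros) of total sum n. *)
Definition is_partition (n : nat) (l : {ffun 'I_n -> 'I_n.+1}) : bool :=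
  [forall i : 'I_n, forall j : 'I_n, (i <= j)%N ==> (l j <= l i)%N]
  && ((\sum_(i < n) (l i : nat)) == n)%N.

(* Elementary symmetric function e_lambda = prod_i e_{lambda_i} (e_0 = 1). *)
Definition e_basis (n : nat) (l : {ffun 'I_n -> 'I_n.+1}) : {mpoly rat[n]} :=
  \prod_(i < n) mesym n rat (l i).

(* Young diagram (English convention): cell (i, j) with j < lambda_i. *)
Definition in_shape (n : nat) (l : {ffun 'I_n -> 'I_n.+1}) (c : 'I_n * 'I_n)
  : bool := (c.2 < l c.1)%N.

Definition opt_le (n : nat) (a b : option 'I_n) : bool :=
  if a is Some x then (if b is Some y then (x <= y)%N else false) else false.
Definition opt_lt (n : nat) (a b : option 'I_n) : bool :=
  if a is Some x then (if b is Some y then (x < y)%N else false) else false.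

Definition is_ssyt (n : nat) (l : {ffun 'I_n -> 'I_n.+1})
    (T : {ffun 'I_n * 'I_n -> option 'I_n}) : bool :=
  [forall c, (in_shape l c) == (T c != None)] &&
  [forall c, forall d, (in_shape l c && in_shape l d) ==>
     (((c.1 == d.1) && (c.2.+1 == d.2)%N) ==> opt_le (T c) (T d)) &&
     (((c.2 == d.2) && (c.1.+1 == d.1)%N) ==> opt_lt (T c) (T d))].

Definition tab_weight (n : nat) (T : {ffun 'I_n * 'I_n -> option 'I_n})
  : {mpoly rat[n]} :=
  \prod_(c : 'I_n * 'I_n) (if T c is Some k then 'X_k else 1).

Definition schur (n : nat) (l : {ffun 'I_n -> 'I_n.+1}) : {mpoly rat[n]} :=
  \sum_(T : {ffun 'I_n * 'I_n -> option 'I_n} | is_ssyt l T) tab_weight T.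

(* Nonnegative expansion in the e-basis / Schur basis (the expansion over
   partitions of n is unique since these are bases). *)
Definition e_positive (T : finType) (adj : rel T) : Prop :=
  exists c : {ffun 'I_#|T| -> 'I_#|T|.+1} -> rat,
    (forall l, is_partition l -> 0 <= c l) /\
    chromsym adj = \sum_(l | is_partition l) c l *: e_basis l.

Definition schur_positive (T : finType) (adj : rel T) : Prop :=
  exists c : {ffun 'I_#|T| -> 'I_#|T|.+1} -> rat,
    (forall l, is_partition l -> 0 <= c l) /\
    chromsym adj = \sum_(l | is_partition l) c l *: schur l.

Definition tri_vertex (r s t : nat) := ('I_r + 'I_s + 'I_t)%type.

Definition tri_part (r s t : nat) (x : tri_vertex r s t) : nat :=
  match x with inl (inl _) => 0 | inl (inr _) => 1 | inr _ => 2 end%N.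

Definition K3adj (r s t : nat) : rel (tri_vertex r s t) :=
  fun x y => tri_part x != tri_part y.

(* Main.v *)
Require Import Defs.
From mathcomp Require Import all_boot all_order all_algebra.
From mathcomp Require Import mpoly.
From mathcomp Require Import ring zify.
Set Implicit Arguments. Unset Strict Implicit. Unset Printing Implicit Defensive.
Import Order.TTheory GRing.Theory Num.Theory.
Local Open Scope ring_scope.

(* For e-positivity: removing one variable x from X_{K_{r,s,t}} amounts to
   removing the vertices coloured x, which lie in a single part, while
   e_k(x, xs) = e_k(xs) + x e_{k-1}(xs). Both sides of each e-expansion thus
   satisfy the same recursion on the number of variables.

   For the negative part: if an SSYT contains i more often than i + 1, then some
   entry i can be raised to i + 1. Hence, when X_G is Schur positive, the
   contents of proper colourings are closed under moving one vertex from the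
   colour i to the colour i + 1 if i is used more often. From the content
   (r, s, t, 0) such moves always reach, except in the five listed cases, a
   content whose entries cannot be merged into the parts r, s, t. *)

(** * Elementary symmetric and chromatic polynomials, variable by variable *)

Section VariableRecursion.
Variable R : comNzRingType.
Implicit Types (x : R) (xs : seq R) (F : nat -> R).

Fixpoint elem k xs : R :=
  match k, xs with
  | 0, _ => 1
  | _.+1, [::] => 0
  | k'.+1, x :: xs' => elem k xs' + x * elem k' xs'
  end.

Lemma elem0 xs : elem 0 xs = 1. Proof. by case: xs. Qed.

Lemma elem_cons k x xs : elem k.+1 (x :: xs) = elem k.+1 xs + x * elem k xs.
Proof. by []. Qed.

Definition binsum x n F : R :=
  \sum_(a < n) 'C(n, a)%:R * x ^+ (n - a) * F a.

Lemma eq_binsum x n F G : F =1 G -> binsum x n F = binsum x n G.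
Proof. by move=> eFG; apply: eq_bigr => a _; rewrite eFG. Qed.

Lemma binsum_small x F :
  (binsum x 0 F = 0) * (binsum x 1 F = x * F 0%N) *
  (binsum x 2 F = x ^+ 2 * F 0%N + 2%:R * x * F 1%N) *
  (binsum x 3 F = x ^+ 3 * F 0%N + 3%:R * x ^+ 2 * F 1%N + 3%:R * x * F 2).
Proof.
by do !split; rewrite /binsum !(big_ord_recr, big_ord0) /= ?add0r
  ?(bin0, bin1, binSn) ?mul1r ?expr1 ?addrA.
Qed.

(* X_{K_{r,s,t}} in the variables xs: the colour x is unused, or it is used on
   r - a vertices of the first part, or similarly for the other two parts. *)
Fixpoint tri xs (r s t : nat) : R :=
  if xs is x :: xs' then
    tri xs' r s t
    + binsum x r (fun a => tri xs' a s t)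
    + binsum x s (fun b => tri xs' r b t)
    + binsum x t (fun c => tri xs' r s c)
  else (r + s + t == 0)%N%:R.

Lemma tri_cons x xs r s t :
  tri (x :: xs) r s t = tri xs r s t
    + binsum x r (fun a => tri xs a s t)
    + binsum x s (fun b => tri xs r b t)
    + binsum x t (fun c => tri xs r s c).
Proof. by []. Qed.

Lemma triC12 xs r s t : tri xs r s t = tri xs s r t.
Proof.
elim: xs r s t => [|x xs IH] r s t /=; first by rewrite (addnC r).
rewrite (IH r s t) (eq_binsum x r (fun a => IH a s t)).
rewrite (eq_binsum x s (fun b => IH r b t)) (eq_binsum x t (fun c => IH r s c)).
by congr (_ + _); exact: addrAC.
Qed.

Lemma triC23 xs r s t : tri xs r s t = tri xs r t s.
Proof.
elim: xs r s t => [|x xs IH] r s t /=; first by rewrite -!addnA (addnC s).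
rewrite (IH r s t) (eq_binsum x r (fun a => IH a s t)).
rewrite (eq_binsum x s (fun b => IH r b t)) (eq_binsum x t (fun c => IH r s c)).
exact: addrAC.
Qed.

(** Rewrite rules that sort the three sizes into nondecreasing order. The offsets restrict each rule
    to a strict descent, so rewriting terminates; for sizes up to 3 the smaller entry of a descent
    is at most 2. *)
Lemma tri_sorted xs :
  (forall s t, tri xs s.+1 0 t = tri xs 0 s.+1 t) *
  (forall s t, tri xs s.+2 1 t = tri xs 1 s.+2 t) *
  (forall s t, tri xs s.+3 2 t = tri xs 2 s.+3 t) *
  (forall r t, tri xs r t.+1 0 = tri xs r 0 t.+1) *
  (forall r t, tri xs r t.+2 1 = tri xs r 1 t.+2) *
  (forall r t, tri xs r t.+3 2 = tri xs r 2 t.+3).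
Proof. by do !split=> *; first [exact: triC12 | exact: triC23]. Qed.

Lemma tri000 xs : tri xs 0 0 0 = 1.
Proof. by elim: xs => //= x xs ->; rewrite !binsum_small !addr0. Qed.

(** Splitting off the first variable on both sides leaves a polynomial identity in [x] and the
    [elem k xs]. The tuple [lower] holds the expansions for the triples obtained by removing
    vertices from one part. *)
Ltac tri_induction lower :=
  let x := fresh "x" in let xs := fresh "xs" in let IH := fresh "IH" in
  elim=> [|x xs IH]; [by rewrite /=; ring |];
  rewrite tri_cons !binsum_small IH ?tri_sorted ?lower !elem_cons ?elem0; ring.

Lemma tri001 : forall xs,
  tri xs 0 0 1 = elem 1 xs.
Proof. tri_induction (tri000). Qed.

Lemma tri002 : forall xs,
  tri xs 0 0 2 = elem 1 xs ^+ 2.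
Proof. tri_induction (tri000, tri001). Qed.

Lemma tri003 : forall xs,
  tri xs 0 0 3 = elem 1 xs ^+ 3.
Proof. tri_induction (tri000, tri001, tri002). Qed.

Lemma tri011 : forall xs,
  tri xs 0 1 1 = 2%:R * elem 2 xs.
Proof. tri_induction (tri001). Qed.

Lemma tri012 : forall xs,
  tri xs 0 1 2 = 3%:R * elem 3 xs + elem 2 xs * elem 1 xs.
Proof. tri_induction (tri001, tri002, tri011). Qed.

(** The negative coefficients here and for (1,1,3) and (1,2,3) do no harm: these expansions only
    feed the recursion that ends with (2,2,3). *)
Lemma tri013 : forall xs,
  tri xs 0 1 3 =
    4%:R * elem 4 xs + 5%:R * elem 3 xs * elem 1 xs - 2%:R * elem 2 xs ^+ 2
    + elem 2 xs * elem 1 xs ^+ 2.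
Proof. tri_induction (tri001, tri003, tri011, tri012). Qed.

Lemma tri022 : forall xs,
  tri xs 0 2 2 = 12%:R * elem 4 xs + 2%:R * elem 2 xs ^+ 2.
Proof. tri_induction (tri002, tri012). Qed.

Lemma tri023 : forall xs,
  tri xs 0 2 3 =
    35%:R * elem 5 xs + 9%:R * elem 4 xs * elem 1 xs
    + elem 3 xs * elem 2 xs + elem 2 xs ^+ 2 * elem 1 xs.
Proof. tri_induction (tri002, tri003, tri012, tri013, tri022). Qed.

Lemma tri111 : forall xs,
  tri xs 1 1 1 = 6%:R * elem 3 xs.
Proof. tri_induction (tri011). Qed.

Lemma tri112 : forall xs,
  tri xs 1 1 2 = 16%:R * elem 4 xs + 2%:R * elem 3 xs * elem 1 xs.
Proof. tri_induction (tri011, tri012, tri111). Qed.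

Lemma tri113 : forall xs,
  tri xs 1 1 3 =
    40%:R * elem 5 xs + 16%:R * elem 4 xs * elem 1 xs
    - 4%:R * elem 3 xs * elem 2 xs + 2%:R * elem 3 xs * elem 1 xs ^+ 2.
Proof. tri_induction (tri011, tri013, tri111, tri112). Qed.

Lemma tri122 : forall xs,
  tri xs 1 2 2 =
    70%:R * elem 5 xs + 6%:R * elem 4 xs * elem 1 xs
    + 2%:R * elem 3 xs * elem 2 xs.
Proof. tri_induction (tri012, tri022, tri112). Qed.

Lemma tri123 : forall xs,
  tri xs 1 2 3 =
    276%:R * elem 6 xs + 49%:R * elem 5 xs * elem 1 xs
    + 4%:R * elem 4 xs * elem 2 xs + 3%:R * elem 4 xs * elem 1 xs ^+ 2
    - 3%:R * elem 3 xs ^+ 2 + elem 3 xs * elem 2 xs * elem 1 xs.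
Proof. tri_induction (tri012, tri013, tri023, tri112, tri113, tri122). Qed.

Lemma tri222 : forall xs,
  tri xs 2 2 2 =
    384%:R * elem 6 xs + 36%:R * elem 5 xs * elem 1 xs
    + 6%:R * elem 3 xs ^+ 2.
Proof. tri_induction (tri022, tri122). Qed.

Lemma tri223 : forall xs,
  tri xs 2 2 3 =
    1988%:R * elem 7 xs + 268%:R * elem 6 xs * elem 1 xs
    + 12%:R * elem 5 xs * elem 2 xs + 12%:R * elem 5 xs * elem 1 xs ^+ 2
    + 4%:R * elem 4 xs * elem 3 xs + 2%:R * elem 3 xs ^+ 2 * elem 1 xs.
Proof. tri_induction (tri022, tri023, tri122, tri123, tri222). Qed.

End VariableRecursion.

(** The generating function links the recursion for [elem] with the sum over subsets that defines
    [mesym]. *)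
Lemma elem_coef (R : comNzRingType) k (xs : seq R) :
  elem k xs = (\prod_(x <- xs) (x *: 'X + 1))`_k.
Proof.
elim: xs k => [|x xs IH] [|k]; rewrite ?big_nil ?big_cons ?coef1 //= mulrDl mul1r.
  by rewrite coefD -scalerAl coefZ coefXM mulr0 add0r -IH elem0.
by rewrite coefD -scalerAl coefZ coefXM /= -!IH addrC.
Qed.

Lemma mesym_elem (R : comNzRingType) n k :
  mesym n R k = elem k [seq 'X_i | i <- enum 'I_n].
Proof.
rewrite elem_coef big_map big_enum /= bigA_distr coef_sum /mesym.
rewrite big_mkcond; apply: eq_bigr => J _.
have -> : \prod_i (if i \in J then 'X_i *: 'X else 1) =
    \prod_(i in J) ('X_i *: 'X) :> {poly {mpoly R[n]}}.
  by rewrite [RHS]big_mkcond.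
rewrite scaler_prod prodr_const coefZ coefXn eq_sym.
by case: eqP; rewrite ?mulr1 ?mulr0.
Qed.

(** * Summing over proper colourings one colour class at a time *)

Section ColourByColour.
Variables (R : comNzRingType) (T : finType) (adj : rel T).
Implicit Types (V B : {set T}) (xs : seq R).

Definition stable B := [forall u in B, forall v in B, ~~ adj u v].

(** The chromatic symmetric polynomial of the subgraph induced on [V]: [B] is the colour class of
    the first variable. *)
Fixpoint colsum xs V : R :=
  if xs is x :: xs' then
    \sum_(B : {set T} | (B \subset V) && stable B) x ^+ #|B| * colsum xs' (V :\: B)
  else (V == set0)%:R.

Variables (J : finType) (x : J -> R) (k0 : T -> J).

Definition proper_on V (k : {ffun T -> J}) :=
  [forall u in V, forall v in V, adj u v ==> (k u != k v)].

(* Colourings of V are represented by functions on T equal to k0 outside V. *)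
Definition colourings V (js : seq J) :=
  [pred k : {ffun T -> J} | proper_on V k &&
     [forall v, if v \in V then k v \in js else k v == k0 v]].

Lemma proper_onP V (k : {ffun T -> J}) :
  reflect (forall u v, u \in V -> v \in V -> adj u v -> k u != k v)
          (proper_on V k).
Proof.
apply: (iffP forall_inP) => [H u v uV vV uv | H u uV].
  by have /forall_inP/(_ v vV)/implyP := H u uV; apply.
by apply/forall_inP => v vV; apply/implyP => uv; apply: H.
Qed.

Lemma stableP B : reflect (forall u v, u \in B -> v \in B -> ~~ adj u v) (stable B).
Proof.
apply: (iffP forall_inP) => [H u v uB vB | H u uB].
  by have /forall_inP/(_ v vB) := H u uB.
by apply/forall_inP => v vB; apply: H.
Qed.

Lemma sum_colourings V js : uniq js ->
  \sum_(k in colourings V js) \prod_(v in V) x (k v) = colsum (map x js) V.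
Proof.
elim: js V => [|j js IH] V /= => [_|/andP[jjs ujs]].
  have [->|/set0Pn[v vV]] := eqVneq V set0; last first.
    rewrite big_pred0 // => k; apply: contraTF vV => /andP[_ /forallP/(_ v)].
    by case: ifP.
  rewrite (big_pred1 (finfun k0)) ?big_set0 // => k; rewrite inE /=.
  apply/andP/eqP => [[_ /forallP H]|->]; last first.
    by split; [apply/proper_onP=> u v; rewrite inE|apply/forallP => v; rewrite inE ffunE].
  by apply/ffunP => v; rewrite ffunE; move: (H v); rewrite inE => /eqP.
rewrite (partition_big (fun k : {ffun T -> J} => [set v in V | k v == j])
   (fun B : {set T} => (B \subset V) && stable B)); last first.
  move=> k /andP[/proper_onP kP _]; apply/andP; split.
    by apply/subsetP => v; rewrite inE => /andP[].
  apply/stableP => u v; rewrite !inE => /andP[uV /eqP ku] /andP[vV /eqP kv].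
  by apply/negP => uv; have := kP u v uV vV uv; rewrite ku kv eqxx.
apply: eq_bigr => B /andP[/subsetP sBV /stableP stB]; rewrite -IH // mulr_sumr.
(* [h] paints [B] with [j], and [h'] resets [B] to the default [k0]. They are inverse bijections
   between the colourings of [V :\: B] by [js] and the colourings of [V] whose class of colour [j]
   is [B]. *)
pose h (k : {ffun T -> J}) := [ffun v => if v \in B then j else k v].
pose h' (k : {ffun T -> J}) := [ffun v => if v \in B then k0 v else k v].
rewrite (reindex_onto h h') /=; last first.
  move=> k /andP[_ /eqP/setP eB]; apply/ffunP=> v; rewrite !ffunE.
  by case: ifP => [|->] //; rewrite -eB inE => /andP[_ /eqP ->].
apply: eq_big => [k|k].
  rewrite !inE; apply/idP/idP.
    case/andP=> /andP[/andP[/proper_onP kP /forallP kV] /eqP/setP eB] /eqP/ffunP hk.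
    apply/andP; split.
      apply/proper_onP => u v; rewrite !inE => /andP[uB uV] /andP[vB vV] uv.
      by have := kP u v uV vV uv; rewrite !ffunE (negbTE uB) (negbTE vB).
    apply/forallP => v; rewrite !inE; have := kV v; have := eB v; have := hk v.
    rewrite !inE !ffunE; case: (boolP (v \in B)) => /= vB.
      by move=> ->.
    by case: ifP => //= _ _ ->.
  case/andP=> /proper_onP kP /forallP kV; have kB v : v \in B -> k v = k0 v.
    by move=> vB; have := kV v; rewrite !inE vB => /eqP.
  have kj v : v \in V -> v \notin B -> k v \in js.
    by move=> vV vB; have := kV v; rewrite !inE vB vV.
  have kjF v : v \in V -> v \notin B -> (k v == j) = false.
    by move=> vV vB; apply: contraNF jjs => /eqP <-; exact: kj.
  apply/andP; split; last first.
    by apply/eqP/ffunP => v; rewrite !ffunE; case: ifP => [vB|->] //; rewrite kB.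
  apply/andP; split; last first.
    apply/eqP/setP=> v; rewrite !inE !ffunE; case: ifP => [vB|vB].
      by rewrite eqxx sBV.
    by case: (boolP (v \in V)) => //= vV; rewrite kjF ?vB.
  apply/andP; split.
    apply/proper_onP => u v uV vV uv; rewrite !ffunE.
    case: ifP => uB; case: ifP => vB.
    - by have := stB u v uB vB; rewrite uv.
    - by rewrite eq_sym kjF ?vB.
    - by rewrite kjF ?uB.
    - by apply: kP; rewrite // inE ?uB ?vB.
  apply/forallP => v; rewrite !ffunE; have := kV v; rewrite !inE.
  case: (boolP (v \in B)) => vB /=; first by rewrite sBV // eqxx.
  by case: ifP => // _ ->; rewrite orbT.
move=> _; rewrite (big_setID B) /= (setIidPr _); last exact/subsetP.
congr (_ * _).
  by rewrite -prodr_const; apply: eq_bigr => v vB; rewrite ffunE vB.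
by apply: eq_bigr => v; rewrite inE ffunE => /andP[/negbTE->].
Qed.

End ColourByColour.

Lemma chromsym_colsum (T : finType) (adj : rel T) :
  chromsym adj = colsum adj [seq 'X_i | i <- enum 'I_#|T|] [set: T].
Proof.
(* [enum_rank] is merely a map from vertices to colours, supplied as the default colouring. *)
rewrite -(sum_colourings _ _ enum_rank) ?enum_uniq //.
apply: eq_big => [k|k _]; last by apply: eq_bigl => v; rewrite inE.
rewrite inE /=; apply/idP/andP => [/forallP H|[/proper_onP H _]].
  split; first by apply/proper_onP => u v _ _ uv; have /forallP/(_ v)/implyP := H u; apply.
  by apply/forallP => v; rewrite inE mem_enum.
by apply/forallP => u; apply/forallP => v; apply/implyP; apply: H; rewrite inE.
Qed.

Lemma sum_nonempty_subsets (R : comNzRingType) (T : finType) (A : {set T}) (x : R)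
    (F : nat -> R) :
  \sum_(B : {set T} | (B \subset A) && (B != set0)) x ^+ #|B| * F #|A :\: B| =
  binsum x #|A| F.
Proof.
have cardD (B : {set T}) : B \subset A -> (#|A :\: B| = #|A| - #|B|)%N.
  by move=> sBA; rewrite cardsD (setIidPr sBA).
(* Each term becomes a sum over its only possible value [a = #|A :\: B|], so that the two sums can
   be exchanged; then ['C(#|A|, a)] subsets remain for each [a]. *)
rewrite (eq_bigr (fun B : {set T} => \sum_(a < #|A| | (#|B| == #|A| - a)%N)
  x ^+ (#|A| - a) * F a)); last first.
  move=> B /andP[sBA B0]; have leBA := subset_leq_card sBA.
  have lt : (#|A| - #|B| < #|A|)%N.
    by rewrite ltn_subrL card_gt0 B0 (leq_trans _ leBA) // card_gt0.
  rewrite (big_pred1 (Ordinal lt)) /= ?cardD ?subKn // => a.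
  rewrite /= -val_eqE /=; have := ltn_ord a.
  by move: (nat_of_ord a) leBA; lia.
rewrite (exchange_big_dep xpredT) //=; apply: eq_bigr => a _.
rewrite sumr_const -mulrA mulr_natl -(bin_sub (ltnW (ltn_ord a))) -cards_draws.
congr (_ *+ _); apply: eq_card => B; rewrite [LHS]unfold_in !inE -andbA; congr (_ && _).
have [cB|] := eqVneq #|B| (#|A| - a)%N; last by rewrite andbF.
by rewrite -card_gt0 cB subn_gt0 ltn_ord.
Qed.

(** * The chromatic symmetric function of a complete tripartite graph *)

Section Tripartite.
Variables (R : comNzRingType) (r s t : nat).
Implicit Types (B V : {set tri_vertex r s t}).

Definition part_of V p := [set v in V | tri_part v == p].

Lemma part_ofD V B p q : B \subset part_of V p ->
  part_of (V :\: B) q = if q == p then part_of V p :\: B else part_of V q.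
Proof.
move=> /subsetP sB; apply/setP => v; rewrite !inE.
case: (eqVneq q p) => [->|qp]; rewrite !inE -?andbA //.
case: (boolP (v \in B)) => //= /sB; rewrite inE => /andP[_ /eqP->].
by rewrite eq_sym (negbTE qp) andbF.
Qed.

Lemma colsum_tri (xs : seq R) V :
  colsum (@K3adj r s t) xs V =
  tri xs #|part_of V 0| #|part_of V 1| #|part_of V 2|.
Proof.
elim: xs V => [|x xs IH] V /=.
  congr (nat_of_bool _)%:R; rewrite !addn_eq0 !cards_eq0.
  apply/eqP/andP => [->|[/andP[/eqP/setP V0 /eqP/setP V1] /eqP/setP V2]].
    by rewrite -!subset0; do !split; rewrite ?andbT //; do ?[apply/andP; split];
       apply/subsetP => v; rewrite !inE.
  apply/setP => v; have := V0 v; have := V1 v; have := V2 v; rewrite !inE.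
  by case: v => [[v|v]|v] /=; rewrite ?andbT.
rewrite (bigD1 set0) /=; last first.
  by rewrite sub0set; apply/stableP => u v; rewrite inE.
rewrite cards0 expr0 mul1r setD0 IH -!addrA; congr (_ + _).
have split_part p : (p < 3)%N ->
  \sum_(B : {set tri_vertex r s t} | (B \subset part_of V p) && (B != set0))
    x ^+ #|B| * colsum (@K3adj r s t) xs (V :\: B) =
  binsum x #|part_of V p| (fun a => tri xs (if p == 0 then a else #|part_of V 0|)
    (if p == 1 then a else #|part_of V 1|) (if p == 2 then a else #|part_of V 2|)).
  move=> p3; rewrite -sum_nonempty_subsets; apply: eq_bigr => B /andP[sB _].
  rewrite IH !(part_ofD _ sB) !(fun_if (fun X : {set _} => #|X|)).
  by move: p p3 sB => [|[|[|p]]].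
have /= <- := split_part 0 isT; have /= <- := split_part 1 isT.
have /= <- := split_part 2 isT.
(* Term by term: a nonempty [B] containing [v] can only occur in the sum for the part of [v]. *)
rewrite !(big_mkcond (fun B => _ && _)) -!big_split /=; apply: eq_bigr => B _.
have [->|/set0Pn[v vB]] := eqVneq B set0; first by rewrite !andbF !addr0.
have sub_other q : q != tri_part v -> B \subset part_of V q = false.
  move=> qv; apply/negbTE/subsetPn; exists v => //.
  by rewrite !inE eq_sym (negbTE qv) andbF.
have sub_part : (B \subset V) && stable (@K3adj r s t) B =
    (B \subset part_of V (tri_part v)).
  apply/andP/subsetP => [[/subsetP sBV /stableP stB] u uB|sB].
    by rewrite inE sBV //= -[_ == _]negbK; exact: stB.
  split; first by apply/subsetP => u /sB; rewrite inE => /andP[].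
  apply/stableP => u w /sB + /sB; rewrite !inE => /andP[_ /eqP pu] /andP[_ /eqP pw].
  by rewrite /K3adj pu pw eqxx.
rewrite !andbT sub_part; move: sub_other; have: (tri_part v < 3)%N.
  by case: (v) => [[]|].
case: (tri_part v) => [|[|[|//]]] _ sub_other.
- by rewrite !(sub_other 1%N, sub_other 2) ?addr0.
- by rewrite !(sub_other 0%N, sub_other 2) ?addr0 ?add0r.
- by rewrite !(sub_other 1%N, sub_other 0%N) ?add0r.
Qed.

End Tripartite.

Lemma card_tri_part r s t p :
  #|[pred v : tri_vertex r s t | tri_part v == p]| = nth 0%N [:: r; s; t] p.
Proof.
rewrite -sum1_card big_mkcond !big_sumType /=.
have sumE m (f : 'I_m -> tri_vertex r s t) q : (forall i, tri_part (f i) = q) ->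
    (\sum_(i < m) (if f i \in [pred v | tri_part v == p] then 1 else 0) =
     (q == p) * m)%N.
  move=> fq; rewrite (eq_bigr (fun=> nat_of_bool (q == p))) => [|i _].
    by rewrite sum_nat_const card_ord mulnC.
  by rewrite inE fq; case: eqP.
rewrite (sumE _ _ 0%N) // (sumE _ _ 1%N) // (sumE _ _ 2) //.
by case: p {sumE} => [|[|[|p]]]; rewrite /= ?nth_nil ?mul1n ?mul0n ?addn0 ?add0n.
Qed.

Lemma chromsym_K3 r s t : chromsym (@K3adj r s t) =
  tri [seq 'X_i | i <- enum 'I_#|{: tri_vertex r s t}|] r s t.
Proof.
rewrite chromsym_colsum colsum_tri.
have card_part_ofT p : #|part_of [set: tri_vertex r s t] p| = nth 0%N [:: r; s; t] p.
  by rewrite -card_tri_part; apply: eq_card => v; rewrite !inE.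
by rewrite !card_part_ofT.
Qed.

(** * The e-positive cases *)

Section EPositivity.
Variable n : nat.

Definition ecomb (p : {mpoly rat[n]}) : Prop :=
  exists c : {ffun 'I_n -> 'I_n.+1} -> rat,
    (forall l, is_partition l -> 0 <= c l) /\
    p = \sum_(l | is_partition l) c l *: e_basis l.

Lemma ecombD p q : ecomb p -> ecomb q -> ecomb (p + q).
Proof.
move=> [c [c0 ->]] [d [d0 ->]]; exists (fun l => c l + d l); split.
  by move=> l lP; rewrite addr_ge0 ?c0 ?d0.
by rewrite -big_split; apply: eq_bigr => l _; rewrite scalerDl.
Qed.

(** Padding [s] with zeros to length [n] gives an encoded partition; the padding only contributes
    factors e_0 = 1. The coefficient function is concentrated at this partition. *)
Lemma ecomb_term (a : nat) (s : seq nat) :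
  sorted geq s -> all (leq 1) s -> sumn s = n ->
  ecomb (a%:R * \prod_(k <- s) mesym n rat k).
Proof.
move=> ss s1 sn; have les : (size s <= n)%N.
  by rewrite -sn; elim: s s1 {ss sn} => //= k s IH /andP[k1 /IH]; lia.
have nth_le i : (nth 0 s i < n.+1)%N.
  rewrite ltnS -{}sn; elim: s i {ss s1 les} => [|k s IH] [|i] //=.
    exact: leq_addr.
  by rewrite (leq_trans (IH i)) ?leq_addl.
pose l : {ffun 'I_n -> 'I_n.+1} := [ffun i : 'I_n => Ordinal (nth_le i)].
have prod_l (R : comNzRingType) (F : nat -> R) : F 0%N = 1 ->
    \prod_(i < n) F (l i) = \prod_(k <- s) F k.
  move=> F0; rewrite (big_nth 0%N) big_mkord.
  rewrite (big_ord_widen n (fun i : nat => F (nth 0%N s i)) les) [RHS]big_mkcond.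
  apply: eq_bigr => i _; rewrite ffunE /=; case: ltnP => // h.
  by rewrite nth_default.
have lP : is_partition l.
  apply/andP; split.
    apply/forallP => i; apply/forallP => j; apply/implyP => ij.
    rewrite !ffunE /=; have [js|js] := ltnP j (size s); last by rewrite nth_default.
    apply: (sorted_leq_nth _ _ _ ss) => //.
    - by move=> x y z; rewrite /geq; lia.
    - by move=> x; rewrite /geq /=.
    - by rewrite inE (leq_ltn_trans ij).
  rewrite -[X in _ == X]sn sumnE (big_nth 0%N) big_mkord.
  rewrite (big_ord_widen n (fun i : nat => nth 0%N s i) les) [X in _ == X]big_mkcond.
  apply/eqP/eq_bigr => i _; rewrite ffunE /=; case: ltnP => // h.
  by rewrite nth_default.
exists (fun l' => if l' == l then a%:R else 0); split.
  by move=> l' _; case: eqP.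
rewrite [RHS](bigD1 l) //= eqxx [X in _ = _ + X]big1 ?addr0; last first.
  by move=> l' /andP[_ /negbTE->]; rewrite scale0r.
by rewrite /e_basis (prod_l _ (mesym n rat)) ?mesym0E // scaler_nat mulr_natl.
Qed.

Lemma ecomb_sum (ts : seq (nat * seq nat)) :
  all (fun u => [&& sorted geq u.2, all (leq 1) u.2 & sumn u.2 == n]) ts ->
  ecomb (\sum_(u <- ts) u.1%:R * \prod_(k <- u.2) mesym n rat k).
Proof.
elim: ts => [_|[a s] ts IH /= /andP[/and3P[ss s1 /eqP sn] /IH]].
  rewrite big_nil; exists (fun=> 0); split=> //.
  by rewrite big1 // => l _; rewrite scale0r.
by rewrite big_cons; apply: ecombD; apply: ecomb_term.
Qed.

End EPositivity.

(** [ts] lists coefficients and partitions of an explicit e-expansion; its coefficients are natural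
    numbers, hence nonnegative. *)
Lemma e_positive_K3 r s t (ts : seq (nat * seq nat)) :
  all (fun u => [&& sorted geq u.2, all (leq 1) u.2 & sumn u.2 == r + s + t]%N) ts ->
  (forall (R : comNzRingType) (xs : seq R),
     tri xs r s t = \sum_(u <- ts) u.1%:R * \prod_(k <- u.2) elem k xs) ->
  e_positive (@K3adj r s t).
Proof.
move=> tsP triE; have cardT : (r + s + t)%N = #|{: tri_vertex r s t}|.
  by rewrite !card_sum !card_ord.
rewrite cardT in tsP; have := ecomb_sum tsP; rewrite /e_positive chromsym_K3 triE.
congr ecomb; apply: eq_bigr => u _; congr (_ * _).
by apply: eq_bigr => k _; rewrite mesym_elem.
Qed.

Lemma K3_e_positive :
  [/\ e_positive (@K3adj 1 1 1), e_positive (@K3adj 1 1 2),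
      e_positive (@K3adj 1 2 2), e_positive (@K3adj 2 2 2)
    & e_positive (@K3adj 2 2 3)].
Proof.
split.
- apply: (@e_positive_K3 _ _ _ [:: (6, [:: 3])]) => // R xs.
  by rewrite tri111 !(big_cons, big_nil) /=; ring.
- apply: (@e_positive_K3 _ _ _ [:: (16, [:: 4]); (2, [:: 3; 1])]%N)
    => // R xs.
  by rewrite tri112 !(big_cons, big_nil) /=; ring.
- apply: (@e_positive_K3 _ _ _ [:: (70, [:: 5]); (6, [:: 4; 1]); (2, [:: 3; 2])]%N)
    => // R xs.
  by rewrite tri122 !(big_cons, big_nil) /=; ring.
- apply: (@e_positive_K3 _ _ _ [:: (384, [:: 6]); (36, [:: 5; 1]); (6, [:: 3; 3])]%N)
    => // R xs.
  by rewrite tri222 !(big_cons, big_nil) /=; ring.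
- apply: (@e_positive_K3 _ _ _ [:: (1988, [:: 7]); (268, [:: 6; 1]); (12, [:: 5; 2]);
    (12, [:: 5; 1; 1]); (4, [:: 4; 3]); (2, [:: 3; 3; 1])]%N)
    => // R xs.
  by rewrite tri223 !(big_cons, big_nil) /=; ring.
Qed.

(** * Raising an entry of a semistandard tableau *)

Section Tableaux.
Variables (n : nat) (l : {ffun 'I_n -> 'I_n.+1}).
Implicit Types (c d : 'I_n * 'I_n) (T : {ffun 'I_n * 'I_n -> option 'I_n}).

Definition content T : 'X_{1..n} := [multinom #|[pred c | T c == Some k]| | k < n].

Lemma tab_weightE T : tab_weight T = 'X_[content T].
Proof.
rewrite /tab_weight (eq_bigr (fun c => 'X_[oapp (fun k => U_(k)%MM) 0%MM (T c)])).
  rewrite mprodXE; congr 'X_[_]; apply/mnmP => k; rewrite mnm_sumE mnmE -sum1_card.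
  rewrite [RHS]big_mkcond; apply: eq_bigr => c _; rewrite inE.
  case: (T c) => [j|] /=; last by rewrite mnm0E.
  rewrite mnm1E; case: (eqVneq j k) => [->|jk]; first by rewrite eqxx.
  by case: eqP => // -[] /eqP; rewrite (negbTE jk).
by move=> c _; case: (T c) => [k|] //=; rewrite mpolyX0.
Qed.

(** Here and in [below], the second argument is the cell adjacent to the right of, or just below,
    the first. *)
Definition right_of c d := (c.1 == d.1) && (c.2.+1 == d.2)%N.
Definition below c d := (c.2 == d.2) && (c.1.+1 == d.1)%N.

Lemma is_ssytP T : reflect
  [/\ forall c, in_shape l c = (T c != None),
      forall c d x y, T c = Some x -> T d = Some y -> right_of c d -> (x <= y)%N
    & forall c d x y, T c = Some x -> T d = Some y -> below c d -> (x < y)%N]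
  (is_ssyt l T).
Proof.
apply: (iffP andP) => [[/forallP shT /forallP ordT]|[shT rT bT]].
  have sh c : in_shape l c = (T c != None) by move: (shT c) => /eqP.
  have ord c d x y : T c = Some x -> T d = Some y ->
      (right_of c d -> (x <= y)%N) /\ (below c d -> (x < y)%N).
    move=> Tc Td; have := ordT c => /forallP/(_ d).
    rewrite !sh Tc Td /= => /andP[/implyP H1 /implyP H2].
    by split.
  by split=> // c d x y Tc Td; case: (ord c d x y Tc Td).
split; first by apply/forallP => c; rewrite shT.
apply/forallP => c; apply/forallP => d; rewrite !shT.
case Tc: (T c) => [x|] //=; case Td: (T d) => [y|] //=.
by apply/andP; split; apply/implyP; [exact: rT|exact: bT].
Qed.

(* If i occurs more often than i + 1, then some i can be raised to i + 1:
   mapping every i that has an i + 1 just below it to that i + 1 is injective,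
   so some i has no i + 1 just below it; the rightmost such i works. *)
Lemma raise_entry T (i j : 'I_n) : is_ssyt l T -> j = i.+1 :> nat ->
  (content T j < content T i)%N ->
  exists T', is_ssyt l T' /\ (content T' + U_(i) = content T + U_(j))%MM.
Proof.
move=> /is_ssytP[sh rT bT] ji; rewrite !mnmE => ltc.
pose good c := (T c == Some i) && [forall d, below c d ==> (T d != Some j)].
have [c0 good_c0] : exists c, good c.
  apply/existsP; apply: contraLR ltc => /existsPn nogood; rewrite -leqNgt.
  have next c : T c = Some i -> exists d, below c d && (T d == Some j).
    move=> Tc; have := nogood c; rewrite /good Tc eqxx /= negb_forall => /existsP[d].
    by rewrite negb_imply negbK => ?; exists d.
  pose f c := odflt c [pick d | below c d && (T d == Some j)].
  have fP c : T c = Some i -> below c (f c) && (T (f c) == Some j).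
    by move=> /next[d dP]; rewrite /f; case: pickP => //= /(_ d); rewrite dP.
  have injf : {in [pred c | T c == Some i] &, injective f}.
    move=> [c1 c2] [d1 d2]; rewrite !inE => /eqP/fP/andP[h1 _] /eqP/fP/andP[h2 _] ef.
    move: h1 h2; rewrite ef /below /=; case: (f _) => a1 a2 /=.
    move=> /andP[/eqP-> /eqP e1] /andP[/eqP-> /eqP e2].
    by have -> : c1 = d1 by apply/val_inj/succn_inj; rewrite e1 e2.
  rewrite -(card_in_imset injf); apply/subset_leq_card/subsetP => d.
  by case/imsetP => c; rewrite !inE => /eqP/fP/andP[_ ?] ->.
have [c /andP[/eqP Tc /forallP bc] maxc] : exists2 c, good c &
    forall d, good d -> (d.2 <= c.2)%N.
  by case: (arg_maxnP (fun c : 'I_n * 'I_n => c.2 : nat) good_c0) => c; exists c.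
pose T' := [ffun d => if d == c then Some j else T d].
have T'E d y : T' d = Some y ->
    d = c /\ y = j \/ d != c /\ T d = Some y.
  by rewrite ffunE; case: (eqVneq d c) => [-> [<-]|dc Td]; [left | right].
exists T'; split.
  apply/is_ssytP; split.
  - by move=> d; rewrite sh ffunE; case: (eqVneq d c) => // ->; rewrite Tc.
  - move=> d1 d2 x y /T'E[[-> ->]|[d1c T1]] /T'E[[-> ->]|[d2c T2]].
    + by [].
    (* The row order at the right neighbour [d2] of [c] fails only if [d2] also contains [i]; then
       [d2] would be good, against the choice of [c] as rightmost. *)
    + move=> cd2; have := rT _ _ _ _ Tc T2 cd2; rewrite leq_eqVlt ji.
      case/orP=> // /eqP iy; have yi : y = i by exact/val_inj/esym.
      rewrite yi in T2.
      suff: good d2.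
        by move/maxc; case/andP: cd2 => _ /eqP <-; rewrite ltnn.
      (* If [j] stood below [d2], the cell [d'] below [c] would hold an entry above [i] and at most
         [j], hence [j], so [c] would not be good. *)
      rewrite /good T2 eqxx; apply/forallP => d; apply/implyP => /andP[d2d d2d'].
      apply/negP => /eqP Td.
      have c1n : (c.1.+1 < n)%N.
        by case/andP: cd2 => /eqP -> _; rewrite (eqP d2d').
      pose d' := (Ordinal c1n, c.2).
      have cd' : below c d' by rewrite /below !eqxx.
      have d'd : right_of d' d.
        case/andP: cd2 => /eqP e1 /eqP e2; rewrite /right_of -(eqP d2d) -e2 eqxx andbT.
        by rewrite -val_eqE /= e1.
      have : in_shape l d'.
        have : in_shape l d by rewrite sh Td.
        rewrite /in_shape; case/andP: (d'd) => /eqP <- /eqP <-; exact: ltnW.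
      rewrite sh; case Td': (T d') => [z|] // _.
      have := rT _ _ _ _ Td' Td d'd; have := bT _ _ _ _ Tc Td' cd'.
      rewrite ji => h1 h2; have/val_inj zj : z = j :> nat.
        by rewrite ji; apply/eqP; rewrite eqn_leq h1 h2.
      by have := bc d'; rewrite cd' Td' zj eqxx.
    + by move=> d1c'; rewrite (leq_trans (rT _ _ _ _ T1 Tc d1c')) // ji.
    + exact: rT.
  - move=> d1 d2 x y /T'E[[-> ->]|[d1c T1]] /T'E[[-> ->]|[d2c T2]].
    + by rewrite /below => /andP[_]; rewrite eqn_leq ltnn.
    (* The entry below [c] exceeds [i] and is not [i + 1], since [c] is good. *)
    + move=> cd2; have := bT _ _ _ _ Tc T2 cd2; rewrite ji leq_eqVlt.
      case/orP=> // /eqP e; have yj : y = j by apply: val_inj; rewrite /= ji.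
      by have := bc d2; rewrite cd2 T2 yj eqxx.
    + by move=> d1c'; rewrite (leq_trans (bT _ _ _ _ T1 Tc d1c')) // ji.
    + exact: bT.
apply/mnmP => k; rewrite !mnmDE !mnm1E !mnmE.
rewrite (cardD1 c [pred d | T' d == _]) (cardD1 c [pred d | T d == _]).
rewrite !inE ffunE eqxx Tc !(inj_eq Some_inj).
rewrite (eq_card (B := [predD1 [pred d | T d == Some k] & c])).
  by rewrite addnAC [RHS]addnAC (addnC (j == k)).
by move=> d; rewrite !inE ffunE; case: eqP.
Qed.

End Tableaux.

(** * Contents of colourings of a Schur positive graph *)

Lemma mcoeff_sumX n (I : finType) (P : pred I) (F : I -> 'X_{1..n}) m :
  ((\sum_(i | P i) 'X_[F i] : {mpoly rat[n]})@_m =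
   #|[pred i | P i && (F i == m)]|%:R).
Proof.
rewrite raddf_sum /= -[in RHS]sum1_card natr_sum big_mkcondr.
by apply: eq_bigr => i _; rewrite mcoeffX; case: eqP.
Qed.

(** A coefficient counts the objects of content [m], so its positivity means that a colouring or a
    tableau of that content exists. *)
Lemma mcoeff_sumX_gt0 n (I : finType) (P : pred I) (F : I -> 'X_{1..n}) m :
  reflect (exists i, P i /\ F i = m)
    (0 < (\sum_(i | P i) 'X_[F i] : {mpoly rat[n]})@_m).
Proof.
rewrite mcoeff_sumX ltr0n; apply: (iffP card_gt0P) => -[i].
  by rewrite inE => /andP[Pi /eqP Fi]; exists i.
by case=> Pi Fi; exists i; rewrite inE Pi Fi eqxx.
Qed.

Lemma mcoeff_sumX_ge0 n (I : finType) (P : pred I) (F : I -> 'X_{1..n}) m :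
  0 <= (\sum_(i | P i) 'X_[F i] : {mpoly rat[n]})@_m.
Proof. by rewrite mcoeff_sumX ler0n. Qed.

Section Transfer.
Variables (V : finType) (adj : rel V).
Notation n := #|V|.

Definition col_content (k : {ffun V -> 'I_n}) : 'X_{1..n} :=
  [multinom #|[pred v | k v == i]| | i < n].

Definition colourable (m : 'X_{1..n}) :=
  exists k : {ffun V -> 'I_n}, proper_coloring adj k /\ col_content k = m.

Lemma chromsymE : chromsym adj =
  \sum_(k : {ffun V -> 'I_n} | proper_coloring adj k) 'X_[col_content k].
Proof.
apply: eq_bigr => k _; rewrite mprodXE; congr 'X_[_]; apply/mnmP => i.
rewrite mnm_sumE mnmE -[RHS]sum1_card [RHS]big_mkcond; apply: eq_bigr => v _.
by rewrite mnm1E inE; case: eqP.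
Qed.

Lemma schurE l : schur l =
  \sum_(T : {ffun 'I_n * 'I_n -> option 'I_n} | is_ssyt l T) 'X_[content T].
Proof. by apply: eq_bigr => T _; rewrite tab_weightE. Qed.

(* The coefficient of x^m in X_G is a nonnegative combination of Kostka numbers
   K_(l, m), so it stays positive when every K_(l, -) that is positive at m is
   positive at m'. *)
Lemma colourable_transfer (m m' : 'X_{1..n}) : schur_positive adj ->
  (forall l : {ffun 'I_n -> 'I_n.+1},
     (exists T, is_ssyt l T /\ content T = m) ->
     exists T, is_ssyt l T /\ content T = m') ->
  colourable m -> colourable m'.
Proof.
case=> c [c0 cE] mm' /mcoeff_sumX_gt0; rewrite -chromsymE cE raddf_sum /= => pos.
apply/mcoeff_sumX_gt0; rewrite -chromsymE cE raddf_sum /=.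
have ge0 l q : is_partition l -> 0 <= (c l *: schur l)@_q.
  by move=> lP; rewrite mcoeffZ mulr_ge0 ?c0 // schurE mcoeff_sumX_ge0.
(* A positive sum has a nonzero term; this [l] will also give a positive term at [m']. *)
have [l /andP[lP]] : exists l, is_partition l && ((c l *: schur l)@_m != 0).
  apply/existsP; apply: contraLR pos => /existsPn all0.
  rewrite big1 ?ltxx // => l lP; apply/eqP.
  by have := all0 l; rewrite lP /= negbK.
rewrite mcoeffZ mulf_eq0 negb_or => /andP[cl sl].
rewrite (bigD1 l) //= ltr_wpDr ?sumr_ge0 //; first by move=> l' /andP[? _]; exact: ge0.
rewrite mcoeffZ mulr_gt0 ?lt0r ?cl ?c0 //.
rewrite -lt0r schurE; apply/mcoeff_sumX_gt0/mm'/mcoeff_sumX_gt0.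
by rewrite -schurE lt0r sl schurE mcoeff_sumX_ge0.
Qed.

Definition seq_content (s : seq nat) : 'X_{1..n} := [multinom nth 0%N s i | i < n].

(** [raise_entry] turns every tableau of content [s] into one of the same shape with content [s'].
    The move of one unit from [i] to [i + 1] is stated additively to avoid truncated subtraction. *)
Lemma colourable_move (s s' : seq nat) i : schur_positive adj ->
  (i.+1 < n)%N -> (nth 0 s i.+1 < nth 0 s i)%N ->
  (forall k, nth 0 s' k + (k == i) = nth 0 s k + (k == i.+1))%N ->
  colourable (seq_content s) -> colourable (seq_content s').
Proof.
move=> sp lti lts ss'; apply: colourable_transfer => // l [T [Tl cT]].
pose a : 'I_n := Ordinal (ltnW lti); pose b : 'I_n := Ordinal lti.
have [||T' [T'l cT']] := @raise_entry _ l T a b Tl; rewrite ?cT ?mnmE //.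
exists T'; split => //; apply/mnmP => k; have /mnmP/(_ k) := cT'.
rewrite cT !mnmDE !mnm1E !mnmE -!val_eqE /=.
by have := ss' k; rewrite ![nat_of_ord k == _]eq_sym => <- /addIn.
Qed.

End Transfer.

(** * Contents of proper colourings of a complete tripartite graph *)

Section Tripartite.
Variables r s t : nat.
Notation V := (tri_vertex r s t).

Lemma card_vertices : #|{: V}| = (r + s + t)%N.
Proof. by rewrite !card_sum !card_ord. Qed.

(** Vertices of equal colour are nonadjacent, so each colour class lies in one part, and each part
    is a union of colour classes. *)
Lemma colourable_merge (w : seq nat) : (size w <= #|{: V}|)%N ->
  colourable (@K3adj r s t) (seq_content V w) ->
  exists f : nat -> nat, forall p,
    nth 0%N [:: r; s; t] p = (\sum_(k < size w) (f k == p) * nth 0 w k)%N.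
Proof.
move=> szw [k [kP kw]].
pose f i := if [pick v | k v == i :> nat] is Some v then tri_part v else 3.
exists f => p; rewrite -card_tri_part.
have fk v : f (k v) = tri_part v.
  rewrite /f; case: pickP => [u /eqP/val_inj kuv|/(_ v)]; last by rewrite eqxx.
  move/forallP/(_ u)/forallP/(_ v)/implyP: kP; rewrite kuv eqxx => h.
  by apply/eqP/negPn/negP => /h.
rewrite (big_ord_widen #|{: V}| (fun i : nat => (f i == p) * nth 0 w i)%N) //.
rewrite [RHS]big_mkcond -[LHS]sum1_card (partition_big k xpredT) //=.
apply: eq_bigr => i _.
have /mnmP/(_ i) := kw; rewrite !mnmE => cki.
have -> : (if (i < size w)%N then (f i == p) * nth 0 w i else 0)%N =
    ((f i == p) * nth 0 w i)%N.
  by case: ltnP => // h; rewrite nth_default ?muln0.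
rewrite -cki -[#|[pred v | k v == i]|]sum1_card; case: (eqVneq (f i) p) => fip.
  rewrite mul1n; apply: eq_bigl => v; rewrite !inE.
  by case: (eqVneq (k v) i) => [kv|]; rewrite ?andbF // -fk kv fip eqxx.
rewrite mul0n big_pred0 // => v; rewrite inE.
case: (eqVneq (k v) i) => [kv|]; rewrite ?andbF // -fk kv.
by rewrite (negbTE fip).
Qed.

Lemma colourable_parts (q : seq nat) : (0 < r)%N -> (0 < s)%N -> (0 < t)%N ->
  perm_eq [:: r; s; t] q -> colourable (@K3adj r s t) (seq_content V q).
Proof.
move=> r0 s0 t0 permq; have /= sizeq := perm_size permq.
(* [js] lists, for each part, the position of its size in [q]; this position becomes the colour of
   the whole part. *)
have /(perm_iotaP 0%N)[js permj rst] := permq.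
have szj : size js = 3 by rewrite (perm_size permj) size_iota.
have uj : uniq js by rewrite (perm_uniq permj) iota_uniq.
have memj i : (i \in js) = (i < 3)%N by rewrite (perm_mem permj) mem_iota -sizeq.
have part3 v : (tri_part (v : V) < 3)%N by case: v => [[]|].
(* Three nonempty parts have at least three vertices, so the colours 0, 1 and 2 exist. *)
have ltk v : (nth 0%N js (tri_part (v : V)) < #|{: V}|)%N.
  apply: (@leq_trans 3); last by rewrite card_vertices; lia.
  by rewrite -memj mem_nth ?szj.
exists [ffun v => Ordinal (ltk v)]; split.
  apply/forallP => u; apply/forallP => v; apply/implyP => uv.
  by rewrite !ffunE -val_eqE /= nth_uniq ?szj.
apply/mnmP => i; rewrite !mnmE.
have [i3|i3] := ltnP i 3; last first.
  rewrite nth_default -?sizeq //; apply: eq_card0 => v.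
  rewrite !inE ffunE -val_eqE /=; apply/negbTE; apply: contraTneq i3 => <-.
  by rewrite -ltnNge -memj mem_nth ?szj.
have ij : nat_of_ord i \in js by rewrite memj.
rewrite -(nth_index 0%N ij) -(nth_map 0%N 0%N) ?index_mem //.
rewrite -rst -card_tri_part; apply: eq_card => v.
rewrite !inE ffunE -val_eqE /= -{1}(nth_index 0%N ij).
by rewrite nth_uniq ?szj // -szj index_mem.
Qed.

End Tripartite.


(* The parts a, b, c are obtained by merging the numbers x, y, z, u, where f0 is
   the index of the part to which x contributes, and so on. *)
Definition merges_to x y z u a b c := exists f0 f1 f2 f3 : nat,
  [/\ a = (f0 == 0) * x + (f1 == 0) * y + (f2 == 0) * z + (f3 == 0) * u,
      b = (f0 == 1) * x + (f1 == 1) * y + (f2 == 1) * z + (f3 == 1) * u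
    & c = (f0 == 2) * x + (f1 == 2) * y + (f2 == 2) * z + (f3 == 2) * u]%N.

Lemma colourable_merges_to r s t (a b c x y z u : nat) : (4 <= r + s + t)%N ->
  perm_eq [:: a; b; c] [:: r; s; t] ->
  colourable (@K3adj r s t) (seq_content _ [:: x; y; z; u]) ->
  merges_to x y z u a b c.
Proof.
rewrite -{1}card_vertices => n4 /(perm_iotaP 0%N)[js permj rst].
have szj : size js = 3 by rewrite (perm_size permj).
have memj i : (i \in js) = (i < 3)%N by rewrite (perm_mem permj) mem_iota.
case/(@colourable_merge _ _ _ [:: x; y; z; u] n4) => f fP.
(* [g] translates part indices into positions in the triple [a], [b], [c]; a value of [f] that is no
   part index goes to 3. *)
pose g k := index (f k) js.
have gP p : (p < 3)%N -> nth 0%N [:: a; b; c] p =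
    ((g 0 == p) * x + (g 1 == p) * y + (g 2 == p) * z + (g 3 == p) * u)%N.
  move=> p3; rewrite rst (nth_map 0%N) ?szj // fP !big_ord_recr big_ord0 /= add0n.
  have gE k : (f k == nth 0%N js p) = (g k == p).
    apply/eqP/eqP => [gp|gp].
      by rewrite /g gp index_uniq ?szj // (perm_uniq permj) iota_uniq.
    by rewrite -gp nth_index // -index_mem szj [index _ _]gp.
  by rewrite !gE.
by exists (g 0), (g 1), (g 2), (g 3); split;
  [exact: (gP 0%N) | exact: (gP 1%N) | exact: (gP 2)].
Qed.

(** * Reachable contents that do not merge into the parts *)

Ltac merge_cases :=
  case=> [] [|[|[|?]]] [] [|[|[|?]]] [] [|[|[|?]]] [] [|[|[|?]]] [-> -> ->];
  rewrite /= ?mul0n ?mul1n ?addn0 ?add0n ?eqxx ?orbT //=; lia.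

(** Each of the three positive parts needs one of the three numbers, so each receives exactly
    one. *)
Lemma merges_to3 (x y z a b c : nat) :
  merges_to x y z 0 a b c -> (0 < a)%N -> (0 < b)%N -> (0 < c)%N ->
  (a \in [:: x; y; z]) && (c \in [:: x; y; z]).
Proof. rewrite !inE; merge_cases. Qed.

(** At most one part receives more than one of the four numbers, so among any two parts one equals a
    single number. *)
Lemma merges_to4 (x y z u a b c : nat) :
  merges_to x y z u a b c -> (0 < a)%N -> (0 < b)%N -> (0 < c)%N ->
  ((a \in [:: x; y; z; u]) || (b \in [:: x; y; z; u])) &&
  ((b \in [:: x; y; z; u]) || (c \in [:: x; y; z; u])).
Proof. rewrite !inE; merge_cases. Qed.

Lemma merges_to_cube a : merges_to a a.-1 a.-1 2 a a a -> (a < 3)%N.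
Proof.
case=> [] [|[|[|?]]] [] [|[|[|?]]] [] [|[|[|?]]] [] [|[|[|?]]] [];
  rewrite /= ?mul0n ?mul1n ?addn0 ?add0n; lia.
Qed.

Lemma unmergeable_reachable (P : nat -> nat -> nat -> nat -> Prop) (a b c : nat) :
  (forall x y z u, (y <= x)%N -> P x.+1 y z u -> P x y.+1 z u) ->
  (forall x y z u, (z <= y)%N -> P x y.+1 z u -> P x y z.+1 u) ->
  (forall x y z u, (u <= z)%N -> P x y z.+1 u -> P x y z u.+1) ->
  P a b c 0%N -> (0 < c)%N -> (c <= b)%N -> (b <= a)%N ->
  ~~ [|| (a == 1) && (b == 1) && (c == 1), (a == 2) && (b == 1) && (c == 1),
     (a == 2) && (b == 2) && (c == 1), (a == 2) && (b == 2) && (c == 2) |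
     (a == 3) && (b == 2) && (c == 2)]%N ->
  exists x y z u, P x y z u /\ ~ merges_to x y z u a b c.
Proof.
move=> step0 step1 step2 Pabc c0 cb ba notsmall.
(* A gap of at least 2 between neighbours is narrowed by one move. Afterwards [a], or [c] in the
   second case, is not among the three entries. *)
have [ab2|ab2] := leqP (b + 2) a.
  have [k ak] : exists k, a = k.+1 by exists a.-1; lia.
  exists k, b.+1, c, 0%N; split; first by apply: (step0); [lia | rewrite -ak].
  by move/merges_to3; rewrite !inE; lia.
have [bc2|bc2] := leqP (c + 2) b.
  have [k bk] : exists k, b = k.+1 by exists b.-1; lia.
  exists a, k, c.+1, 0%N; split; first by apply: (step1); [lia | rewrite -bk].
  by move/merges_to3; rewrite !inE; lia.
(* The sizes are (c+2, c+1, c); two moves lead to (c+1, c+1, c+1), which lacks [a]. *)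
have [ac2|ac2] := leqP (c + 2) a.
  have [ak bk] : a = c.+2 /\ b = c.+1 by lia.
  exists c.+1, c.+1, c.+1, 0%N; split.
    by apply: (step1) => //; apply: (step0) => //; rewrite -ak -bk.
  by move/merges_to3; rewrite !inE; lia.
(* All sizes now differ by at most 1, and two units are moved to the fourth colour: (a,a,a) yields
   (a,a-1,a-1,2), (c+1,c+1,c) yields (c,c,c,2), and (c+1,c,c) yields (c+1,c-1,c-1,2). Excluding the
   listed cases makes the parts large enough; the moves are applied from the last to the first. *)
have [e|ne] := eqVneq b a.
  have [e'|ne'] := eqVneq c a.
    have [k ak] : exists k, a = k.+3 by exists (a - 3)%N; lia.
    exists a, a.-1, a.-1, 2; split; last by rewrite e e' => /merges_to_cube; lia.
    rewrite e e' ak /= in Pabc *; apply: (step1) => //.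
    by apply: (step2) => //; exact: (step2).
  have [k ck] : exists k, c = k.+2 by exists (c - 2)%N; lia.
  have ak : a = k.+3 by lia.
  rewrite e ck ak in Pabc *.
  exists k.+2, k.+2, k.+2, 2; split.
    2: by move/merges_to4; rewrite !inE; clear; lia.
  apply: (step2) => //; apply: (step1) => //; apply: (step0) => //; apply: (step1) => //.
  exact: (step2).
have [k ck] : exists k, c = k.+3 by exists (c - 3)%N; lia.
have [ak bk] : a = k.+4 /\ b = k.+3 by lia.
rewrite ak bk ck in Pabc *; exists k.+4, k.+2, k.+2, 2; split.
  2: by move/merges_to4; rewrite !inE; clear; lia.
apply: (step1) => //; apply: (step2) => //; exact: (step2).
Qed.

(** * Failure of Schur positivity outside the five cases *)

Lemma K3_not_schur_positive_sorted r s t (a b c : nat) :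
  (0 < r)%N -> (0 < s)%N -> (0 < t)%N -> perm_eq [:: a; b; c] [:: r; s; t] ->
  (c <= b <= a)%N ->
  ~~ [|| (a == 1) && (b == 1) && (c == 1), (a == 2) && (b == 1) && (c == 1),
     (a == 2) && (b == 2) && (c == 1), (a == 2) && (b == 2) && (c == 2) |
     (a == 3) && (b == 2) && (c == 2)]%N ->
  ~ schur_positive (@K3adj r s t).
Proof.
move=> r0 s0 t0 permq /andP[cb ba] notsmall sp.
have sumq : (r + s + t = a + b + c)%N.
  by have := perm_sumn permq; rewrite /= !addn0 !addnA.
have c0 : (0 < c)%N.
  have : c \in [:: r; s; t] by rewrite -(perm_mem permq) !inE eqxx !orbT.
  by rewrite !inE => /or3P[] /eqP->.
(* Only (1,1,1) has fewer than four vertices, and it is excluded; so a fourth colour is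
   available. *)
have n4 : (4 <= r + s + t)%N by lia.
have step w w' i : (i.+1 < 4)%N -> (nth 0 w i.+1 < nth 0 w i)%N ->
    (forall k, nth 0%N w' k + (k == i) = nth 0 w k + (k == i.+1))%N ->
    colourable (@K3adj r s t) (seq_content _ w) ->
    colourable (@K3adj r s t) (seq_content _ w').
  move=> i4; apply: colourable_move => //; rewrite card_vertices.
  exact: leq_trans i4 n4.
pose P x y z u := colourable (@K3adj r s t) (seq_content _ [:: x; y; z; u]).
have col : P a b c 0%N.
  rewrite /P; have -> : seq_content (tri_vertex r s t) [:: a; b; c; 0%N] =
            seq_content (tri_vertex r s t) [:: a; b; c].
    by apply/mnmP => -[[|[|[|[|i]]]] lti]; rewrite !mnmE //= nth_nil.
  by apply: colourable_parts => //; rewrite perm_sym.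
have step0 x y z u : (y <= x)%N -> P x.+1 y z u -> P x y.+1 z u.
  by move=> le; apply: (step _ _ 0%N) => // -[|[|k]] /=; rewrite ?addn0 ?addn1.
have step1 x y z u : (z <= y)%N -> P x y.+1 z u -> P x y z.+1 u.
  by move=> le; apply: (step _ _ 1%N) => // -[|[|[|k]]] /=; rewrite ?addn0 ?addn1.
have step2 x y z u : (u <= z)%N -> P x y z.+1 u -> P x y z u.+1.
  by move=> le; apply: (step _ _ 2) => // -[|[|[|[|k]]]] /=; rewrite ?addn0 ?addn1.
have [//|x [y [z [u [colw]]]]] :=
  @unmergeable_reachable P a b c step0 step1 step2 col c0 cb ba.
by apply; exact: colourable_merges_to colw.
Qed.

Theorem theorem3p7 :
  [/\ e_positive (@K3adj 1 1 1), e_positive (@K3adj 1 1 2),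
      e_positive (@K3adj 1 2 2), e_positive (@K3adj 2 2 2)
    & e_positive (@K3adj 2 2 3)] /\
  (forall r s t : nat, (1 <= r)%N -> (1 <= s)%N -> (1 <= t)%N ->
     ~~ perm_eq [:: r; s; t] [:: 1; 1; 1]%N ->
     ~~ perm_eq [:: r; s; t] [:: 1; 1; 2]%N ->
     ~~ perm_eq [:: r; s; t] [:: 1; 2; 2]%N ->
     ~~ perm_eq [:: r; s; t] [:: 2; 2; 2]%N ->
     ~~ perm_eq [:: r; s; t] [:: 2; 2; 3]%N ->
     ~ schur_positive (@K3adj r s t)).
Proof.
split; first exact: K3_e_positive.
move=> r s t r0 s0 t0 n111 n112 n122 n222 n223.
have [a [b [c [permq abc]]]] : exists a b c : nat,
    perm_eq [:: a; b; c] [:: r; s; t] /\ (c <= b <= a)%N.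
  have := sort_sorted (fun x y => leq_total y x) [:: r; s; t].
  have := permEl (perm_sort geq [:: r; s; t]).
  move: (sort _ _) => q permq; have := perm_size permq.
  case: q permq => [|a [|b [|c [|]]]] //= permq _ /and3P[ba cb _].
  by exists a, b, c; rewrite cb ba.
apply: (K3_not_schur_positive_sorted r0 s0 t0 permq abc).
rewrite perm_sym in permq; apply/negP.
move=> /or4P[| | |/orP[]] /andP[/andP[/eqP ea /eqP eb] /eqP ec]; move: permq;
  rewrite {}ea {}eb {}ec => permq.
- by case/negP: n111.
- by case/negP: n112; apply: perm_trans permq _.
- by case/negP: n122; apply: perm_trans permq _.
- by case/negP: n222.
- by case/negP: n223; apply: perm_trans permq _.
Qed.
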